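(* Let $\mu=\mu_1\otimes\cdots\otimes\mu_n$ be a product probability measure on $\mathbb{R}^n$, where each $\mu_k$ is a probability measure on $\mathbb{R}$ with density $g_k\in L^\infty(\mathbb{R})$. Then for every convex set $A\subset\mathbb{R}^n$, $$\mu^+(\partial A)\leq 2\sum_{k=1}^n\|g_k\|_\infty,$$ and consequently $\Gamma(\mu)\leq 2\sum_{k=1}^n\|g_k\|_\infty$. Moreover, the constant $2$ is optimal (it cannot be replaced by any smaller constant valid for all such product measures).
   Context: $B_2^n$ is the Euclidean unit ball. $\mu^+(\partial A)=\liminf_{\epsilon\to0^+}\frac{\mu((A+\epsilon B_2^n)\setminus A)}{\epsilon}$ and $\Gamma(\mu)=\sup\{\mu^+(\partial A): A \text{ a convex body (compact convex set with nonempty interior)}\}$. *)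

(* Defs.v *)
From HB Require Import structures.
From mathcomp Require Import all_boot all_order all_algebra.
From mathcomp Require Import all_classical all_reals all_analysis.
From mathcomp Require Import ess_sup_inf.
Set Implicit Arguments.
Unset Strict Implicit.
Unset Printing Implicit Defensive.
Import Order.TTheory GRing.Theory Num.Theory.
Import numFieldNormedType.Exports.
Local Open Scope classical_set_scope.
Local Open Scope ring_scope.

Section Defs.
Variable R : realType.

(* Points of R^n are functions 'I_n -> R; topology = pointwise (product)
   topology {ptws 'I_n -> R}, which is the Euclidean topology. *)

Definition eball n : set ('I_n -> R) := [set x | \sum_(i < n) x i ^+ 2 <= 1].

Definition mink n (A : set ('I_n -> R)) (eps : R) (B : set ('I_n -> R)) :
  set ('I_n -> R) :=
  [set z | exists a b, A a /\ B b /\ z = (fun i => a i + eps * b i)].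

Definition convex_body n (A : set ('I_n -> R)) : Prop :=
  convex_set A /\ @compact {ptws 'I_n -> R} A /\
  (@interior {ptws 'I_n -> R} A) !=set0.

Definition vcons n (t : R) (y : 'I_n -> R) : 'I_n.+1 -> R :=
  fun i => match unlift ord0 i with None => t | Some j => y j end.

(* iterated Lebesgue integral over R^n (Tonelli form of the n-dim integral) *)
Fixpoint iter_int (n : nat) : (('I_n -> R) -> \bar R) -> \bar R :=
  match n with
  | 0 => fun F => F (fun _ => 0)
  | m.+1 => fun F =>
      (\int[@lebesgue_measure R]_(t in setT)
         iter_int (fun y => F (vcons t y)))%E
  end.

Definition prod_dens_measure n (g : 'I_n -> R -> R) (A : set ('I_n -> R))
  : \bar R :=
  iter_int (fun x => ((\prod_(k < n) g k (x k)) * \1_A x)%:E).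

Definition prob_density_Linf (g : R -> R) : Prop :=
  [/\ measurable_fun setT g, (forall x, 0 <= g x),
      (\int[@lebesgue_measure R]_(x in setT) (g x)%:E = 1)%E &
      (ess_sup (@lebesgue_measure R) (fun x => (`|g x|)%:E) < +oo)%E].

Definition Linf_norm (g : R -> R) : \bar R :=
  ess_sup (@lebesgue_measure R) (fun x => (`|g x|)%:E).

Definition surf_measure n (mu : set ('I_n -> R) -> \bar R)
  (A : set ('I_n -> R)) : \bar R :=
  limf_einf (fun eps : R => (mu (mink A eps (@eball n) `\` A) * (eps^-1)%:E)%E)
    (0^'+).

Definition Gamma n (mu : set ('I_n -> R) -> \bar R) : \bar R :=
  ereal_sup [set surf_measure mu A | A in [set A | convex_body A]].

End Defs.

(* Main.v *)
Require Import Defs.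
From HB Require Import structures.
From mathcomp Require Import all_boot all_order all_algebra.
From mathcomp Require Import all_classical all_reals all_analysis.
From mathcomp Require Import ess_sup_inf measurable_realfun.
From mathcomp Require Import ring lra.
Import Order.TTheory GRing.Theory Num.Theory.
Import numFieldNormedType.Exports.
Local Open Scope classical_set_scope.
Local Open Scope ring_scope.

(**
  Enlarge [A] by the cube [eps [-1,1]^n] instead of the ball, one coordinate
  direction at a time.  All the intermediate sets are convex, so their sections
  along a coordinate axis [k] are intervals, and enlarging in direction [k] adds
  at most [2 eps] to the length of each section; by Tonelli the mass added is at
  most [2 eps ||g_k||_oo].

  A convex set need not be Borel, and [A] may have empty interior, so the chain
  is started from a Borel convex subset [E] of [A] with [A] inside
  [E + del [-1,1]^n]: the convex hull of a countable [del]-net of [A], which is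
  a countable union of compact polytopes.  Enlarging [E] by
  [(eps + del) [-1,1]^n] gives the bound up to [del], and [del] tends to [0].

  For the optimality, take the uniform density on [0,1] and a single point.
*)

Set Implicit Arguments.
Unset Strict Implicit.
Unset Printing Implicit Defensive.

(** * Iterated integrals *)

Section IteratedIntegral.
Variable R : realType.
Implicit Types (n : nat).
Local Notation mu := (@lebesgue_measure R).

Definition measurable_family d (T : measurableType d) n (x : T -> 'I_n -> R) :=
  forall i, measurable_fun [set: T] (fun t => x t i).

(* Measurability along every measurable parametrisation: a stand-in for the
   product sigma-algebra that is stable under fixing coordinates. *)
Definition plot_measurable n (S : set ('I_n -> R)) :=
  forall d (T : measurableType d) (x : T -> 'I_n -> R),
    measurable_family x -> measurable (x @^-1` S).

(** The parameter space [T] absorbs coordinates: peeling off one integration turns a family over [T]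
    into one over [T] times the line, as the inductions on [n] require. *)
Definition plot_measurable_fun d (T : measurableType d) n
    (F : T -> ('I_n -> R) -> \bar R) :=
  forall d' (U : measurableType d') (u : U -> T) (x : U -> 'I_n -> R),
    measurable_fun [set: U] u -> measurable_family x ->
    measurable_fun [set: U] (fun t => F (u t) (x t)).

Lemma vcons0 n (t : R) (y : 'I_n -> R) : vcons t y ord0 = t.
Proof. by rewrite /vcons unlift_none. Qed.

Lemma vcons_lift n (t : R) (y : 'I_n -> R) i : vcons t y (lift ord0 i) = y i.
Proof. by rewrite /vcons liftK. Qed.

Lemma measurable_family_vcons d (T : measurableType d) n (s : T -> R)
    (x : T -> 'I_n -> R) :
  measurable_fun [set: T] s -> measurable_family x ->
  measurable_family (fun t => vcons (s t) (x t)).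
Proof.
move=> ms mx i; case: (unliftP ord0 i) => [j ->|->].
  under eq_fun do rewrite vcons_lift; exact: mx.
by under eq_fun do rewrite vcons0.
Qed.

(* No measurability: the integral of a nonnegative function is the supremum over
   the simple functions below it, i.e. the lower integral. *)
Lemma le_lower_integral d (T : measurableType d)
    (m : {measure set T -> \bar R}) (f g : T -> \bar R) :
  (forall x, 0 <= f x)%E -> (forall x, f x <= g x)%E ->
  (\int[m]_x f x <= \int[m]_x g x)%E.
Proof.
move=> f0 fg; have g0 x : (0 <= g x)%E by exact: le_trans (fg x).
rewrite (ge0_integralTE _ f0) (ge0_integralTE _ g0).
apply: le_ereal_sup => _ [h hf <-]; exists h => // x.
exact: le_trans (hf x) (fg x).
Qed.

Lemma iter_int_ge0 n (F : ('I_n -> R) -> \bar R) :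
  (forall y, 0 <= F y)%E -> (0 <= iter_int F)%E.
Proof.
elim: n F => [|n IH] F F0 /=; first exact: F0.
by apply: integral_ge0 => t _; exact: IH.
Qed.

Lemma le_iter_int n (F G : ('I_n -> R) -> \bar R) :
  (forall y, 0 <= F y)%E -> (forall y, F y <= G y)%E ->
  (iter_int F <= iter_int G)%E.
Proof.
elim: n F G => [|n IH] F G F0 FG /=; first exact: FG.
apply: le_lower_integral => t; first exact: iter_int_ge0.
exact: IH.
Qed.

Lemma plot_measurable_fun_vcons d (T : measurableType d) n
    (F : T -> ('I_n.+1 -> R) -> \bar R) :
  plot_measurable_fun F ->
  plot_measurable_fun
    (fun (ts : T * measurableTypeR R) y => F ts.1 (vcons ts.2 y)).
Proof.
move=> mF d' U u x mu_ mx; apply: (mF _ _ (fst \o u)).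
  exact: measurableT_comp.
apply: measurable_family_vcons => //.
exact: (measurableT_comp measurable_snd).
Qed.

(** Induction with [T] generalised: the first coordinate joins the parameter, and Tonelli integrates
    it out again measurably. *)
Lemma measurable_iter_int d (T : measurableType d) n
    (F : T -> ('I_n -> R) -> \bar R) :
  plot_measurable_fun F -> (forall t y, 0 <= F t y)%E ->
  measurable_fun [set: T] (fun t => iter_int (F t)).
Proof.
elim: n d T F => [|n IH] d T F mF F0 /=.
  by apply: (mF _ _ id) => // i; exact: measurable_cst.
pose G (ts : T * measurableTypeR R) := iter_int (fun y => F ts.1 (vcons ts.2 y)).
have mG : measurable_fun setT G.
  by apply: IH => //; exact: plot_measurable_fun_vcons.
have G0 ts : (0 <= G ts)%E by apply: iter_int_ge0.
exact: (measurable_fun_fubini_tonelli_F (m2 := mu) G mG G0).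
Qed.

(** Tonelli one coordinate at a time: swap [t] with the outermost variable, then use induction for
    the inner ones. *)
Lemma iter_int_exchange n (F : measurableTypeR R -> ('I_n -> R) -> \bar R) :
  plot_measurable_fun F -> (forall t y, 0 <= F t y)%E ->
  (\int[mu]_t iter_int (F t) = iter_int (fun y => \int[mu]_t F t y))%E.
Proof.
elim: n F => [//|n IH] F mF F0 /=.
pose G (ts : measurableTypeR R * measurableTypeR R) :=
  iter_int (fun y => F ts.1 (vcons ts.2 y)).
have mG : measurable_fun setT G.
  by apply: measurable_iter_int => //; exact: plot_measurable_fun_vcons.
have G0 ts : (0 <= G ts)%E by apply: iter_int_ge0.
rewrite (fubini_tonelli (m1 := mu) (m2 := mu) G mG G0) /=.
apply: eq_integral => s _; rewrite /G /= IH //.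
move=> d' U u x mu_ mx; apply: mF => //.
exact: measurable_family_vcons.
Qed.

Lemma iter_int0 n : iter_int (fun _ : 'I_n -> R => 0%E) = 0%E.
Proof.
by elim: n => [//|n IH] /=; rewrite integral0_eq.
Qed.

Lemma iter_intD n d (T : measurableType d)
    (F G : T -> ('I_n -> R) -> \bar R) t :
  plot_measurable_fun F -> (forall t y, 0 <= F t y)%E ->
  plot_measurable_fun G -> (forall t y, 0 <= G t y)%E ->
  (iter_int (fun y => F t y + G t y) = iter_int (F t) + iter_int (G t))%E.
Proof.
elim: n d T F G t => [//|n IH] d T F G t mF F0 mG G0 /=.
have mI (H : T -> ('I_n.+1 -> R) -> \bar R) :
    plot_measurable_fun H -> (forall t y, 0 <= H t y)%E ->
    measurable_fun setT
      (fun s : measurableTypeR R => iter_int (fun y => H t (vcons s y))).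
  move=> mH H0; apply: measurable_iter_int => //.
  move=> d' U u x mu_ mx; apply: (mH _ _ (cst t)); first exact: measurable_cst.
  exact: measurable_family_vcons.
rewrite -ge0_integralD //; first last.
- exact: mI.
- by move=> s _; apply: iter_int_ge0.
- exact: mI.
- by move=> s _; apply: iter_int_ge0.
apply: eq_integral => s _.
apply: (IH _ (T * measurableTypeR R)%type
  (fun ts y => F ts.1 (vcons ts.2 y)) (fun ts y => G ts.1 (vcons ts.2 y)) (t, s));
  by [exact: plot_measurable_fun_vcons|move=> ? ?; exact: F0|move=> ? ?; exact: G0].
Qed.

End IteratedIntegral.

(** * Mass of a set with short sections *)

Section ProductDensity.
Variable R : realType.
Local Notation mu := (@lebesgue_measure R).

(** The essential bound is kept apart, so that it can be imposed on a single coordinate at a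
    time. *)
Definition is_density (g : R -> R) :=
  [/\ measurable_fun [set: R] g, forall x, 0 <= g x &
      (\int[mu]_x (g x)%:E = 1)%E].

Definition update n (x : 'I_n -> R) (k : 'I_n) (t : R) : 'I_n -> R :=
  fun i => if i == k then t else x i.

Lemma update_vcons0 n (y : 'I_n -> R) s t :
  update (vcons s y) ord0 t = vcons t y.
Proof.
apply/funext => i; rewrite /update.
have [->|i0] := eqVneq i ord0; first by rewrite vcons0.
by case: (unliftP ord0 i) i0 => [j ->|-> /eqP //]; rewrite !vcons_lift.
Qed.

Lemma update_vcons_lift n (y : 'I_n -> R) k s t :
  update (vcons s y) (lift ord0 k) t = vcons s (update y k t).
Proof.
apply/funext => i; rewrite /update.
case: (unliftP ord0 i) => [j ->|->]; last by rewrite !vcons0 (negbTE (neq_lift _ _)).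
by rewrite !vcons_lift (inj_eq lift_inj).
Qed.

Lemma plot_measurable_vcons n (S : set ('I_n.+1 -> R)) t :
  plot_measurable S -> plot_measurable [set y | S (vcons t y)].
Proof.
move=> mS d T x mx; apply: (mS _ _ (fun u => vcons t (x u))).
by apply: measurable_family_vcons => //; exact: measurable_cst.
Qed.

(** Each density integrates to 1. The constant [c] is general so that the induction can absorb the
    factor [g ord0 t] into it. *)
Lemma iter_int_density n (g : 'I_n -> R -> R) (c : R) :
  (forall k, is_density (g k)) -> 0 <= c ->
  iter_int (fun y => (\prod_(k < n) g k (y k) * c)%:E) = c%:E.
Proof.
elim: n g c => [|n IH] g c dg c0 /=; first by rewrite big_ord0 mul1r.
have [mg0 g0 ig0] := dg ord0.
transitivity (\int[mu]_t (g ord0 t * c)%:E)%E.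
  apply: eq_integral => t _.
  rewrite -(IH (fun k => g (lift ord0 k)) (g ord0 t * c)) ?mulr_ge0 //.
  congr iter_int; apply/funext => y; rewrite big_ord_recl vcons0.
  under eq_bigr do rewrite vcons_lift.
  by rewrite mulrCA mulrA.
under eq_integral do rewrite mulrC EFinM.
rewrite ge0_integralZl_EFin //.
- by rewrite ig0 mule1.
- by move=> x _; rewrite lee_fin.
- exact/measurable_EFinP.
Qed.

Lemma plot_measurable_density n (g : 'I_n -> R -> R) (c : R)
    (S : set ('I_n -> R)) d (T : measurableType d) :
  (forall k, is_density (g k)) -> plot_measurable S ->
  plot_measurable_fun (fun (_ : T) y =>
    (\prod_(k < n) g k (y k) * (c * \1_S y))%:E).
Proof.
move=> dg mS d' U u x _ mx; apply/measurable_EFinP.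
apply: measurable_funM.
  apply: measurable_prod => k _; have [mg _ _] := dg k.
  exact: (measurableT_comp mg (mx k)).
apply: measurable_funM; first exact: measurable_cst.
have -> : (fun t => \1_S (x t)) = (\1_(x @^-1` S) : U -> R) by [].
exact: measurable_indic (mS _ _ _ mx).
Qed.

(** Along direction [k] the density contributes at most [M] times the length of the section, and the
    other densities integrate to 1. The induction peels off the outermost coordinate. *)
Lemma iter_int_slab n (g : 'I_n -> R -> R) (c M l : R) (k : 'I_n)
    (S : set ('I_n -> R)) :
  (forall i, is_density (g i)) -> 0 <= c -> 0 <= M -> 0 <= l ->
  {ae mu, forall t, g k t <= M} -> plot_measurable S ->
  (forall x, mu [set t | S (update x k t)] <= l%:E)%E ->
  (iter_int (fun y => (\prod_(i < n) g i (y i) * (c * \1_S y))%:E)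
     <= (c * (M * l))%:E)%E.
Proof.
elim: n g c k S => [|n IH] g c k S dg c0 M0 l0 gM mS Sl; first by case: k gM Sl.
have [mg0 g0 ig0] := dg ord0.
have gl0 (y : 'I_n -> R) : 0 <= \prod_(i < n) g (lift ord0 i) (y i).
  by apply: prodr_ge0 => i _; have [_ + _] := dg (lift ord0 i); exact.
have prodE t (y : 'I_n -> R) : \prod_(i < n.+1) g i (vcons t y i) =
    g ord0 t * \prod_(i < n) g (lift ord0 i) (y i).
  rewrite big_ord_recl vcons0; congr (_ * _).
  by apply: eq_bigr => i _; rewrite vcons_lift.
have ind0 (x : 'I_n.+1 -> R) : 0 <= \1_S x :> R by rewrite indicE ler0n.
have prod0 (x : 'I_n.+1 -> R) : 0 <= \prod_(i < n.+1) g i (x i).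
  by apply: prodr_ge0 => i _; have [_ + _] := dg i; exact.
case: (unliftP ord0 k) gM Sl => [j ->|->] gM Sl /=; last first.
  (* Here [k] is the outermost coordinate; its integral is moved innermost so that the section is
     taken with all other coordinates fixed. *)
  rewrite iter_int_exchange; last 2 first.
  - move=> d U u x mu_ mx.
    apply: (@plot_measurable_density _ g c S _ (measurableTypeR R) dg mS
      _ _ u (fun t => vcons (u t) (x t))) => //.
    exact: measurable_family_vcons.
  - by move=> t y; rewrite lee_fin !mulr_ge0.
  have cMl0 : 0 <= c * (M * l) by rewrite !mulr_ge0.
  rewrite -(@iter_int_density n (fun i => g (lift ord0 i)) (c * (M * l))) //.
  apply: le_iter_int => y.
    by apply: integral_ge0 => t _; rewrite lee_fin !mulr_ge0.
  set P := \prod_(i < n) g (lift ord0 i) (y i).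
  pose V := [set t | S (vcons t y)].
  have mV : measurable (V : set (measurableTypeR R)).
    apply: (mS _ _ (fun t => vcons t y)).
    apply: measurable_family_vcons => // i; exact: measurable_cst.
  apply: (@le_trans _ _ (\int[mu]_t ((P * c * M)%:E * (\1_V t)%:E)))%E.
    apply: ae_ge0_le_integral => //.
    - by move=> t _; rewrite lee_fin !mulr_ge0.
    - apply: (@plot_measurable_density _ g c S _ (measurableTypeR R) dg mS
        _ _ id (fun t => vcons t y)) => //.
      by apply: measurable_family_vcons => // i; exact: measurable_cst.
    - by move=> t _; rewrite -EFinM lee_fin !mulr_ge0 // ?gl0 // indicE ler0n.
    - apply: emeasurable_funM; first exact: measurable_cst.
      by apply/measurable_EFinP; exact: measurable_indic.
    - move: gM; apply: (@filterS _ _ (ae_filter_ringOfSetsType mu)) => t gtM _.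
      rewrite -EFinM lee_fin prodE -/P.
      have -> : \1_S (vcons t y) = \1_V t :> R by [].
      have V0 : 0 <= \1_V t :> R by rewrite indicE ler0n.
      have P0 : 0 <= P by exact: gl0.
      rewrite [_ * P]mulrC -!mulrA ler_wpM2l // mulrCA ler_wpM2l //.
      by rewrite ler_wpM2r.
  rewrite ge0_integralZl_EFin //; last first.
  - by rewrite !mulr_ge0 // gl0.
  - by apply/measurable_EFinP; exact: measurable_indic.
  rewrite integral_indic // setIT.
  have -> : (P * (c * (M * l)))%:E = ((P * c * M)%:E * l%:E)%E.
    by rewrite -EFinM !mulrA.
  apply: lee_wpmul2l; first by rewrite lee_fin !mulr_ge0 // gl0.
  (* The entry [0] is arbitrary, since [update] overwrites it. *)
  have := Sl (vcons 0 y).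
  by under eq_set do rewrite update_vcons0.
(* Here [k] is a later coordinate: for fixed [t] the induction hypothesis applies with constant
   [g ord0 t * c]. *)
apply: (@le_trans _ _ (\int[mu]_t ((c * (M * l))%:E * (g ord0 t)%:E)))%E.
  apply: le_lower_integral => t.
    by apply: iter_int_ge0 => y; rewrite lee_fin !mulr_ge0.
  have h := IH (fun i => g (lift ord0 i)) (g ord0 t * c) j
    [set y | S (vcons t y)] (fun i => dg _) _ M0 l0 gM _ _.
  have -> : ((c * (M * l))%:E * (g ord0 t)%:E = (g ord0 t * c * (M * l))%:E)%E.
    by rewrite -EFinM mulrC !mulrA.
  apply: le_trans (h _ _ _).
  - apply: le_iter_int => y; first by rewrite lee_fin !mulr_ge0.
    rewrite lee_fin prodE.
    have -> : \1_S (vcons t y) = \1_[set y | S (vcons t y)] y :> R by [].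
    by rewrite -mulrA mulrCA !mulrA.
  - by rewrite mulr_ge0.
  - exact: plot_measurable_vcons.
  - move=> x; have := Sl (vcons t x).
    by under eq_set do rewrite update_vcons_lift.
rewrite ge0_integralZl_EFin //.
- by rewrite ig0 mule1.
- by move=> t _; rewrite lee_fin.
- exact/measurable_EFinP.
- by rewrite !mulr_ge0.
Qed.

Lemma iter_int_sum n (I : Type) (s : seq I) (F : I -> ('I_n -> R) -> \bar R) :
  (forall i, plot_measurable_fun (fun _ : measurableTypeR R => F i)) ->
  (forall i y, 0 <= F i y)%E ->
  (iter_int (fun y => \sum_(i <- s) F i y) = \sum_(i <- s) iter_int (F i))%E.
Proof.
move=> mF F0; elim: s => [|i s IH].
  rewrite big_nil -[RHS](iter_int0 R n); congr iter_int.
  by apply/funext => y; rewrite big_nil.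
rewrite big_cons -IH.
(* A constant family over a dummy parameter, evaluated at [0]. *)
rewrite -(iter_intD (F := fun _ : measurableTypeR R => F i)
  (G := fun _ : measurableTypeR R => (fun y => \sum_(i <- s) F i y)%E) 0) //.
- by congr iter_int; apply/funext => y; rewrite big_cons.
- move=> d' U u x mu_ mx; apply: emeasurable_sum => j.
  exact: (mF j _ _ u).
- by move=> _ y; apply: sume_ge0.
Qed.

End ProductDensity.

(** * Borel measurability of polytopes *)

Section ClosedSets.
Variable R : realType.

Definition box_closed n (S : set ('I_n -> R)) :=
  forall x, (forall e, 0 < e -> exists2 y, S y & forall i, `|x i - y i| <= e) ->
  S x.

(** Half-open cubes of side [1 / (N + 1)] partition the space; finite functions into [int] form a
    countable index type. *)
Definition cell n (N : nat) (z : {ffun 'I_n -> int}) : set ('I_n -> R) :=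
  [set x | forall i, (z i)%:~R <= N.+1%:R * x i < (z i + 1)%:~R].

Lemma cell_floor n N (x : 'I_n -> R) :
  cell N [ffun i => Num.floor (N.+1%:R * x i)] x.
Proof. by move=> i; rewrite ffunE floor_itv. Qed.

Lemma cell_dist n N z (x y : 'I_n -> R) i :
  cell N z x -> cell N z y -> `|x i - y i| <= N.+1%:R^-1.
Proof.
move=> /(_ i)/andP[x1 x2] /(_ i)/andP[y1 y2].
have N0 : 0 < N.+1%:R :> R by rewrite ltr0n.
rewrite -(@ler_pM2l _ N.+1%:R) // mulfV ?gt_eqF //.
have -> : N.+1%:R * `|x i - y i| = `|N.+1%:R * x i - N.+1%:R * y i|.
  by rewrite -mulrBr normrM gtr0_norm.
move: x2 y2; rewrite !intrD => x2 y2.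
rewrite ler_norml; lra.
Qed.

Lemma plot_measurable_cell n N (z : {ffun 'I_n -> int}) :
  plot_measurable (cell N z).
Proof.
move=> d T x mx.
have -> : x @^-1` cell N z = \bigcap_(i in [set: 'I_n])
    ((fun t => N.+1%:R * x t i) @^-1` `[(z i)%:~R, (z i + 1)%:~R[%classic).
  apply/seteqP; split=> t /=.
    by move=> h i _ /=; rewrite in_itv; exact: h.
  by move=> h i; have := h i I; rewrite /= in_itv.
apply: fin_bigcap_measurable => [|i _]; first exact: finite_finset.
rewrite -[X in measurable X]setTI; exact: measurable_funM.
Qed.

(** A closed set is the intersection over [N] of the unions of the grid cells that meet it, and each
    union is countable. *)
Lemma box_closed_plot_measurable n (S : set ('I_n -> R)) :
  box_closed S -> plot_measurable S.
Proof.
move=> cS d T x mx.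
have -> : x @^-1` S = \bigcap_N \bigcup_(z : {ffun 'I_n -> int})
    (if `[< S `&` cell N z !=set0 >] then x @^-1` cell N z else set0).
  apply/seteqP; split=> t /=.
    move=> St N _; exists [ffun i => Num.floor (N.+1%:R * x t i)] => //.
    rewrite ifT; first exact: cell_floor.
    by apply/asboolP; exists (x t); split => //; exact: cell_floor.
  move=> h; apply: cS => e e0.
  (* This choice of [N] makes the mesh [1 / (N + 1)] smaller than [e]. *)
  have [z _] := h (Num.truncn e^-1) I.
  case: ifPn => // /asboolP[y [Sy cy]] cx; exists y => // i.
  apply: le_trans (cell_dist i cx cy) _.
  rewrite -[leRHS]invrK lef_pV2 ?posrE ?invr_gt0 ?ltr0n //.
  by rewrite ltW // truncnS_gt // invr_ge0 ltW.
apply: bigcapT_measurable => N.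
apply: countable_bigcupT_measurable => [|z]; first exact: countableP.
case: ifP => _ //; exact: plot_measurable_cell.
Qed.

End ClosedSets.

(** * Closedness of polytopes enlarged by a box *)

Section Hull.
Variable R : realType.
Variables (n : nat) (p : nat -> 'I_n -> R).
Implicit Types (w : 'I_n -> R) (a b : nat -> R).

Definition comb (m : nat) a : 'I_n -> R :=
  fun i => \sum_(0 <= j < m) a j * p j i.

Definition weights (m : nat) a :=
  (forall j, 0 <= a j) /\ \sum_(0 <= j < m) a j = 1.

(* The Minkowski sum of the convex hull of [p 0, ..., p m.-1] and of the box
   with half-widths [w]. *)
Definition hull_box m w : set ('I_n -> R) :=
  [set x | exists2 a, weights m a & forall i, `|x i - comb m a i| <= w i].

Lemma continuous_sum (I : Type) (r : seq I) (T : topologicalType)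
    (f : I -> T -> R) :
  (forall j, continuous (f j)) -> continuous (fun t => \sum_(j <- r) f j t).
Proof.
move=> cf; elim: r => [|j r IH] t.
  by under eq_fun do rewrite big_nil; exact: cvg_cst.
have -> : (fun t => \sum_(i <- j :: r) f i t) =
    (fun t => f j t + \sum_(i <- r) f i t).
  by apply/funext => s; rewrite big_cons.
exact: (cvgD (cf j t) (IH t)).
Qed.

Definition excess m w x a i := `|x i - comb m a i| - w i.

(* Nonnegative, and zero exactly when [sum a = 1] and every excess is [<= 0]. *)
Definition misfit m w x a :=
  \sum_(i < n) (excess m w x a i + `|excess m w x a i|)
  + `|\sum_(0 <= j < m) a j - 1|.

Lemma continuous_misfit (T : topologicalType) m w x (f : T -> nat -> R) :
  (forall j, continuous (fun t => f t j)) ->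
  continuous (fun t => misfit m w x (f t)).
Proof.
move=> cf.
have ce i : continuous (fun t => excess m w x (f t) i).
  have cc : continuous (fun t => comb m (f t) i).
    apply: continuous_sum => j s; exact: (cvgM (cf j s) (cvg_cst _)).
  move=> s; apply: cvgB (cvg_cst _).
  exact: (cvg_norm (cvgB (cvg_cst _) (cc s))).
have c1 : continuous (fun t => \sum_(i < n)
    (excess m w x (f t) i + `|excess m w x (f t) i|)).
  by apply: continuous_sum => i s; exact: (cvgD (ce i s) (cvg_norm (ce i s))).
have c2 : continuous (fun t => \sum_(0 <= j < m) f t j).
  exact: continuous_sum.
by move=> t; exact: (cvgD (c1 t) (cvg_norm (cvgB (c2 t) (cvg_cst _)))).
Qed.

Lemma addr_normr_ge0 (t : R) : 0 <= t + `|t|.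
Proof. by have := ler_norm (- t); rewrite normrN; lra. Qed.

Lemma misfit_ge0_sum m w x a :
  0 <= \sum_(i < n) (excess m w x a i + `|excess m w x a i|).
Proof.
by apply: sumr_ge0 => i _; exact: addr_normr_ge0.
Qed.

Lemma misfit_le0 m w x a : (forall j, 0 <= a j) -> misfit m w x a <= 0 ->
  hull_box m w x.
Proof.
rewrite /misfit => a0 h; have s0 := misfit_ge0_sum m w x a.
have t0 := normr_ge0 (\sum_(0 <= j < m) a j - 1).
exists a; [split => //|].
- by apply/eqP; rewrite -subr_eq0 -normr_le0; lra.
- move=> i; rewrite -subr_le0 -/(excess m w x a i).
  have : excess m w x a i + `|excess m w x a i| <= 0.
    apply: (@le_trans _ _ (\sum_(i < n) (excess m w x a i + `|excess m w x a i|))).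
      rewrite (bigD1 i) //= lerDl; apply: sumr_ge0 => k _.
      exact: addr_normr_ge0.
    lra.
  by have := ler_norm (excess m w x a i); lra.
Qed.

(** Compactness of the weights: [misfit] attains its minimum on the Tychonoff cube. Approximating
    points push this minimum below every [e > 0], so the minimiser has misfit at most 0 and is a
    witness. *)
Lemma box_closed_hull_box m w : box_closed (hull_box m w).
Proof.
move=> x hx.
pose C := [set f : prod_topology (fun _ : nat => R) |
  forall j, `[0, 1]%classic (f j)].
have C0 : C !=set0.
  by exists (fun=> 0) => j /=; rewrite in_itv /= lexx ler01.
have cC : compact C.
  exact: (@tychonoff nat (fun=> R) (fun=> `[0, 1]%classic)
    (fun=> @segment_compact R 0 1)).
have cphi : continuous (fun f : prod_topology (fun _ : nat => R) => misfit m w x f).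
  exact: (@continuous_misfit _ m w x (fun f : prod_topology _ => f)
    (@proj_continuous _ (fun _ : nat => R))).
have [c Cc minc] := compact_EVT_min C0 cC (continuous_subspaceT cphi).
apply: (@misfit_le0 _ _ _ c).
  by move=> j; move: Cc; rewrite inE => /(_ j) /=; rewrite in_itv => /andP[].
apply/ler_addgt0Pl => e e0; rewrite addr0.
have n0 : 0 < n.+1%:R :> R by rewrite ltr0n.
(* The [n] terms of the misfit will be at most [2 * e'] each; [n.+1] avoids a division by zero. *)
pose e' := e / (2 * n.+1%:R).
have e'0 : 0 < e' by rewrite divr_gt0 // mulr_gt0.
have [y [a [a0 a1] ay] xy] := hx e' e'0.
(* Beyond [m] the weights are only known to be nonnegative; truncation puts the sequence into the
   cube. *)
pose a' j := if (j < m)%N then a j else 0.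
have a'E (g : nat -> R) :
    \sum_(0 <= j < m) a' j * g j = \sum_(0 <= j < m) a j * g j.
  by apply: eq_big_nat => j /andP[_ jm]; rewrite /a' jm.
have Ca' : a' \in C.
  rewrite inE => j /=; rewrite /a' in_itv /=.
  case: ifP => jm; last by rewrite lexx ler01.
  rewrite a0 /= -a1 big_mkord (bigD1 (Ordinal jm)) //= lerDl.
  by apply: sumr_ge0.
apply: le_trans (minc _ Ca') _.
have -> : misfit m w x a' = \sum_(i < n) (excess m w x a i + `|excess m w x a i|).
  rewrite /misfit -[RHS]addr0; congr (_ + _).
    by apply: eq_bigr => i _; rewrite /excess /comb a'E.
  have -> : \sum_(0 <= j < m) a' j = \sum_(0 <= j < m) a j.
    by apply: eq_big_nat => j /andP[_ jm]; rewrite /a' jm.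
  by rewrite a1 subrr normr0.
apply: (@le_trans _ _ (\sum_(i < n) 2 * e')).
  apply: ler_sum => i _; rewrite /excess.
  have := ler_distD (y i) (x i) (comb m a i).
  have := ay i; have := xy i.
  set u := `|x i - y i|; set v := `|y i - _|; set t := `|x i - _| => u1 v1 t1.
  by have [tw|tw] := ger0P (t - w i); lra.
rewrite sumr_const card_ord -[leLHS]mulr_natr /e'.
have -> : 2 * (e / (2 * n.+1%:R)) * n%:R = e * n%:R / n.+1%:R :> R.
  by field; rewrite gt_eqF.
by rewrite ler_pdivrMr // ler_pM2l // ler_nat.
Qed.

End Hull.

(** * Convex hulls of countable nets *)

Section HullGeometry.
Variable R : realType.
Local Notation mu := (@lebesgue_measure R).

Lemma convex_set_comb n (A : set ('I_n -> R)) x y (t : R) : convex_set A ->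
  0 <= t <= 1 -> A x -> A y -> A (fun i => t * x i + (1 - t) * y i).
Proof.
move=> cA /andP[t0 t1] Ax Ay.
by have := cA x y (Itv01 t0 t1); rewrite !inE => /(_ Ax Ay).
Qed.

Lemma plot_measurable_bigcup n (S : nat -> set ('I_n -> R)) :
  (forall m, plot_measurable (S m)) -> plot_measurable (\bigcup_m S m).
Proof.
by move=> mS d T x mx; rewrite preimage_bigcup; apply: bigcupT_measurable => m; exact: mS.
Qed.

Lemma plot_measurableD n (S S' : set ('I_n -> R)) :
  plot_measurable S -> plot_measurable S' -> plot_measurable (S `\` S').
Proof.
by move=> mS mS' d T x mx; apply: measurableD; [exact: mS|exact: mS'].
Qed.

Variables (n : nat) (p : nat -> 'I_n -> R).

(** With [w = 0] this is the convex hull of the points [p], the Borel set that starts the chain; a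
    general [w] adds a box. *)
Definition hull (w : 'I_n -> R) := \bigcup_m hull_box p m w.

Lemma plot_measurable_hull w : plot_measurable (hull w).
Proof.
apply: plot_measurable_bigcup => m; apply: box_closed_plot_measurable.
exact: box_closed_hull_box.
Qed.

Lemma sum_trunc (m M : nat) (a c : nat -> R) : (m <= M)%N ->
  \sum_(0 <= j < M) (if (j < m)%N then a j else 0) * c j =
  \sum_(0 <= j < m) a j * c j.
Proof.
move=> mM; rewrite (@big_cat_nat _ _ _ m) //= [X in _ + X]big_nat.
rewrite [X in _ + X]big1 ?addr0 => [|j /andP[mj _]]; last first.
  by rewrite ltnNge mj mul0r.
by apply: eq_big_nat => j /andP[_ jm]; rewrite jm.
Qed.

Lemma le_hull_box m M w : (m <= M)%N -> hull_box p m w `<=` hull_box p M w.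
Proof.
move=> mM x [a [a0 a1] ax].
exists (fun j => if (j < m)%N then a j else 0); [split|].
- by move=> j; case: ifP.
- rewrite -a1; have := sum_trunc a (fun=> 1) mM.
  by under eq_bigr do rewrite mulr1; under [RHS]eq_bigr do rewrite mulr1.
- by move=> i; rewrite /comb sum_trunc.
Qed.

(** Padding with zero weights gives both points the same number of terms; their weights can then be
    averaged. *)
Lemma hull_conv w x y t : hull w x -> hull w y -> 0 <= t <= 1 ->
  hull w (fun i => t * x i + (1 - t) * y i).
Proof.
move=> [m _ mx] [m' _ my] /andP[t0 t1]; exists (maxn m m') => //.
have [a [a0 a1] ax] := le_hull_box (leq_maxl m m') mx.
have [b [b0 b1] bx] := le_hull_box (leq_maxr m m') my.
have u0 : 0 <= 1 - t by rewrite subr_ge0.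
exists (fun j => t * a j + (1 - t) * b j); [split|].
- by move=> j; rewrite addr_ge0 // mulr_ge0.
- by rewrite big_split /= -!mulr_sumr a1 b1 !mulr1 addrC subrK.
- move=> i; set M := maxn m m' in a1 ax b1 bx *.
  have -> : comb p M (fun j => t * a j + (1 - t) * b j) i =
      t * comb p M a i + (1 - t) * comb p M b i.
    rewrite /comb !mulr_sumr -big_split /=; apply: eq_bigr => j _.
    by rewrite mulrDl !mulrA.
  have -> : t * x i + (1 - t) * y i
      - (t * comb p M a i + (1 - t) * comb p M b i) =
    t * (x i - comb p M a i) + (1 - t) * (y i - comb p M b i) by ring.
  apply: le_trans (ler_normD _ _) _; rewrite !normrM (ger0_norm t0) (ger0_norm u0).
  have -> : w i = t * w i + (1 - t) * w i by ring.
  by apply: lerD; apply: ler_wpM2l.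
Qed.

(** Partial sums of weights are not normalised, so the induction carries the total mass as a
    factor. *)
Lemma comb_convex (A : set ('I_n -> R)) m a : convex_set A ->
  (forall j, A (p j)) -> (forall j, 0 <= a j) ->
  0 < \sum_(0 <= j < m) a j ->
  exists2 x, A x & comb p m a = (fun i => (\sum_(0 <= j < m) a j) * x i).
Proof.
move=> cA Ap a0; elim: m => [|m IH]; first by rewrite big_geq // ltxx.
rewrite big_nat_recr //=; set L := \sum_(0 <= j < m) a j => Lm.
have L0 : 0 <= L by apply: sumr_ge0.
have combS i : comb p m.+1 a i = comb p m a i + a m * p m i.
  by rewrite /comb big_nat_recr.
have [Lp|Ln] := ltP 0 L.
  have [x Ax Ex] := IH Lp.
  pose t := L / (L + a m).
  exists (fun i => t * x i + (1 - t) * p m i).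
    apply: convex_set_comb => //; rewrite divr_ge0 ?(ltW Lm) //=.
    by rewrite ler_pdivrMr // mul1r lerDl.
  apply/funext => i; rewrite combS Ex -/L /t.
  by field; rewrite gt_eqF.
(* All earlier weights vanish, and only [p m] is left. *)
have L00 : L = 0 by apply/eqP; rewrite eq_le Ln L0.
exists (p m) => //; apply/funext => i.
rewrite combS L00 add0r -[RHS]add0r; congr (_ + _).
rewrite /comb big_nat big1 // => j /andP[_ jm].
suff -> : a j = 0 by rewrite mul0r.
apply/eqP; rewrite eq_le a0 andbT -L00 /L big_mkord (bigD1 (Ordinal jm)) //= lerDl.
by apply: sumr_ge0.
Qed.

(** This allows the complement of [A] to be replaced by the larger complement of a Borel set. *)
Lemma hull0_sub (A : set ('I_n -> R)) : convex_set A -> (forall j, A (p j)) ->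
  hull (fun=> 0) `<=` A.
Proof.
move=> cA Ap x [m _ [a [a0 a1] ax]].
have [|y Ay Ey] := comb_convex (m := m) cA Ap a0; first by rewrite a1.
suff -> : x = y by [].
apply/funext => i; have := ax i; rewrite Ey a1 mul1r normr_le0 subr_eq0.
by move/eqP.
Qed.

Lemma hull_point j x w : (forall i, `|x i - p j i| <= w i) -> hull w x.
Proof.
move=> xw; exists j.+1 => //; exists (fun l => (l == j)%:R); [split|].
- by move=> l; rewrite ler0n.
- rewrite big_nat_recr //= eqxx big_nat big1 ?add0r // => l /andP[_ lj].
  by rewrite ltn_eqF.
- move=> i; rewrite /comb big_nat_recr //= eqxx mul1r.
  rewrite big_nat big1 ?add0r // => l /andP[_ lj].
  by rewrite ltn_eqF // mul0r.
Qed.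

(* Half-widths of the box once the first [k] directions have been enlarged. *)
Definition step_width (eta : R) (k : nat) : 'I_n -> R :=
  fun i => if (i < k)%N then eta else 0.

(** Moving coordinate [k] of [x] onto the approximating convex combination leaves no deviation in
    that direction. *)
Lemma hull_stepS eta (k : 'I_n) x : hull (step_width eta k.+1) x ->
  exists2 s, `|x k - s| <= eta & hull (step_width eta k) (update x k s).
Proof.
move=> [m _ [a aw ax]]; exists (comb p m a k).
  by have := ax k; rewrite /step_width ltnSn.
exists m => //; exists a => // i; rewrite /update /step_width.
have [->|ik] := eqVneq i k; first by rewrite subrr normr0 ltnn.
have := ax i; rewrite /step_width ltnS leq_eqVlt.
by rewrite (inj_eq val_inj) (negbTE ik).
Qed.

End HullGeometry.

(** * Length of a neighbourhood of an interval *)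

Section IntervalNeighbourhood.
Variable R : realType.
Local Notation mu := (@lebesgue_measure R).

(** [L] lies between [inf I - eta] and [inf I]. A point of [L] makes [I] nonempty and bounded below,
    so the infimum is meaningful. *)
Lemma left_collar (I L : set R) (eta : R) :
  (forall t, L t -> exists2 s, I s & t - eta <= s <= t + eta) ->
  (forall t s, L t -> I s -> t <= s) ->
  exists a, L `<=` `[a, a + eta].
Proof.
move=> LI Lle.
have [[l Ll]|L0] := pselect (L !=set0); last first.
  by exists 0 => t Lt; exfalso; apply: L0; exists t.
have hI : has_inf I.
  by split; [have [s Is _] := LI _ Ll; exists s|exists l => s; exact: Lle].
exists (inf I - eta) => t Lt /=; rewrite in_itv /= subrK.
have [s Is /andP[_ st]] := LI _ Lt.
rewrite lb_le_inf ?andbT; last 2 first.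
- by have [] := hI.
- by move=> r; exact: Lle.
by rewrite lerBlDr (le_trans _ st) // ge_inf //; have [] := hI.
Qed.

(** A point of [J] outside the interval [I] lies wholly to its left or wholly to its right, and each
    side has length at most [eta]. *)
Lemma interval_collar (I J : set R) (eta : R) : 0 <= eta ->
  (forall s t r, I s -> I t -> s <= r <= t -> I r) ->
  (forall t, J t -> exists2 s, `|t - s| <= eta & I s) ->
  measurable (J `\` I : set (measurableTypeR R)) ->
  (mu (J `\` I) <= (2 * eta)%:E)%E.
Proof.
move=> eta0 cI JI mJI.
have near t : J t -> exists2 s, I s & t - eta <= s <= t + eta.
  by move=> /JI[s + Is]; rewrite ler_distlC => h; exists s.
pose L := [set t | (J `\` I) t /\ exists2 s, I s & t <= s].
pose U := [set t | (J `\` I) t /\ exists2 s, I s & s <= t].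
have [a La] : exists a, L `<=` `[a, a + eta].
  apply: (@left_collar I) => [t [[Jt _] _]|t s [[_ nIt] [r Ir tr]] Is].
    exact: near.
  rewrite leNgt; apply/negP => st; apply: nIt.
  by apply: (cI s r) => //; rewrite tr ltW.
(* The right side is the left side after the reflection of the line. *)
have [b Ub] : exists b, -%R @` U `<=` `[b, b + eta].
  apply: (@left_collar (-%R @` I)).
    move=> _ [t [[Jt _] _] <-]; have [s Is /andP[s1 s2]] := near _ Jt.
    by exists (- s); [exists s|lra].
  move=> _ _ [t [[_ nIt] [r Ir rt]] <-] [s Is <-].
  rewrite lerN2 leNgt; apply/negP => ts; apply: nIt.
  by apply: (cI r s) => //; rewrite rt ltW.
have sub : J `\` I `<=` `[a, a + eta] `|` `[- (b + eta), - b].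
  move=> t JIt; have [Jt nIt] := JIt; have [s Is _] := near _ Jt.
  have [ts|st] := leP t s; [left; apply: La|right].
    by split => //; exists s.
  have /Ub : (-%R @` U) (- t) by exists t => //; split => //; exists s => //; exact: ltW.
  by rewrite /= !in_itv /=; lra.
apply: (@le_trans _ _ (mu (`[a, a + eta] `|` `[- (b + eta), - b]))).
  by apply: le_measure => //; rewrite inE //; apply: measurableU.
apply: (le_trans (measureU2 _ _ _)) => //.
rewrite /= !lebesgue_measure_itv /= !lte_fin.
(* The length formula branches on strict inequality; the case [eta = 0] agrees. *)
have len (x : R) : (if x < x + eta then ((x + eta)%:E - x%:E)%E else 0%E) = eta%:E.
  case: ifP => [_|]; first by rewrite -EFinD addrAC subrr add0r.
  by rewrite ltrDl => /negbT; rewrite -leNgt => ?; congr EFin; lra.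
have := len (- (b + eta)); have -> : - (b + eta) + eta = - b by ring.
move=> ->; rewrite len -EFinD lee_fin; lra.
Qed.

End IntervalNeighbourhood.

(** * Upper bound *)

Section UpperBound.
Variable R : realType.
Local Notation mu := (@lebesgue_measure R).

(** Pick a point of [A] in each grid cell that meets [A]. The default [x0] keeps the whole sequence
    inside [A]. *)
Lemma countable_net n (A : set ('I_n -> R)) (del : R) : A !=set0 -> 0 < del ->
  exists2 p : nat -> 'I_n -> R, (forall j, A (p j)) &
    forall x, A x -> exists j, forall i, `|x i - p j i| <= del.
Proof.
move=> [x0 Ax0] d0; pose N := Num.truncn del^-1.
have /choice[q hq] (z : {ffun 'I_n -> int}) : exists y,
    A y /\ ((exists x, A x /\ cell N z x) -> cell N z y).
  have [[x [Ax cx]]|nx] := pselect (exists x, A x /\ cell N z x).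
    by exists x.
  by exists x0; split.
exists (fun j => if unpickle j is Some z then q z else x0).
  by move=> j; case: unpickle => // z; have [] := hq z.
move=> x Ax; pose z := [ffun i => Num.floor (N.+1%:R * x i)].
exists (pickle z) => i; rewrite pickleK.
have cz : cell N z (q z).
  by have [_] := hq z; apply; exists x; split => //; exact: cell_floor.
apply: le_trans (cell_dist i (cell_floor N x) cz) _.
rewrite -[leRHS]invrK lef_pV2 ?posrE ?invr_gt0 ?ltr0n //.
by rewrite ltW // truncnS_gt // invr_ge0 ltW.
Qed.

Lemma eball_coord n (b : 'I_n -> R) i : eball b -> `|b i| <= 1.
Proof.
rewrite /eball /= (bigD1 i) //= => h.
have b1 : b i ^+ 2 <= 1.
  apply: le_trans h; rewrite lerDl; apply: sumr_ge0 => j _; exact: sqr_ge0.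
by rewrite ler_norml; apply/andP; split; nra.
Qed.

(** The chain starts at the bare hull, which misses [x], so [x] enters at some step. *)
Lemma hull_telescope n (p : nat -> 'I_n -> R) eta x :
  (hull p (step_width eta n) `\` hull p (fun=> 0)) x ->
  exists k : 'I_n, (hull p (step_width eta k.+1) `\` hull p (step_width eta k)) x.
Proof.
move=> [hn h0].
have w0 : step_width eta 0 = (fun=> 0) :> ('I_n -> R) by [].
have climb m : hull p (step_width eta m) x -> exists2 k, (k < m)%N &
   (hull p (step_width eta k.+1) `\` hull p (step_width eta k)) x.
  elim: m => [|m IH] hm; first by rewrite w0 in hm.
  have [/IH[k km hk]|hm'] := pselect (hull p (step_width eta m) x).
    by exists k => //; exact: ltnW.
  by exists m.
have [k kn hk] := climb _ hn.
by exists (Ordinal kn).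
Qed.

(** The section before the step is an interval by convexity, and [hull_stepS] puts the section after
    it within [eta]. *)
Lemma hull_step_slab n (p : nat -> 'I_n -> R) eta (k : 'I_n) x : 0 <= eta ->
  (mu [set t | (hull p (step_width eta k.+1) `\` hull p (step_width eta k))
                 (update x k t)] <= (2 * eta)%:E)%E.
Proof.
move=> eta0.
pose E m := [set t | hull p (step_width eta m) (update x k t)].
have mE m : measurable (E m : set (measurableTypeR R)).
  apply: (plot_measurable_hull p (step_width eta m)
    (x := fun t => update x k t)) => i.
  rewrite /update; case: (i == k); first exact: measurable_id.
  exact: measurable_cst.
apply: (@interval_collar _ (E k) (E k.+1)) => //.
- move=> s t r Is It /andP[sr rt].
  have [st|ts] := ltP s t; last first.
    by have -> : r = s by apply/eqP; rewrite eq_le sr (le_trans rt ts).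
  (* The weight for which [r = u * s + (1 - u) * t]. *)
  pose u := (t - r) / (t - s).
  have ts0 : 0 < t - s by rewrite subr_gt0.
  have -> : E k r = hull p (step_width eta k)
      (fun i => u * update x k s i + (1 - u) * update x k t i).
    congr (hull _ _ _); apply/funext => i; rewrite /update /u.
    by case: (i == k); field; rewrite gt_eqF.
  apply: hull_conv => //.
  rewrite divr_ge0 ?subr_ge0 ?(ltW st) //= ler_pdivrMr // mul1r; lra.
- move=> t /hull_stepS[s ts hs]; exists s; first by move: ts; rewrite /update eqxx.
  suff -> : E k s = hull p (step_width eta k) (update (update x k t) k s) by [].
  congr (hull _ _ _); apply/funext => i; rewrite /update.
  by case: (i == k).
- exact: measurableD.
Qed.

Lemma density_mink_le n (g : 'I_n -> R -> R) (M : 'I_n -> R)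
    (A : set ('I_n -> R)) (eps : R) :
  (forall k, is_density (g k)) -> (forall k, 0 <= M k) ->
  (forall k, {ae mu, forall t, g k t <= M k}) -> convex_set A -> 0 <= eps ->
  (prod_dens_measure g (mink A eps (@eball R n) `\` A)
    <= (\sum_(k < n) M k * (2 * eps))%:E)%E.
Proof.
move=> dg M0 gM cA eps0.
have ind0 (S : set ('I_n -> R)) x : 0 <= \1_S x :> R by rewrite indicE ler0n.
have prod0 (x : 'I_n -> R) : 0 <= \prod_(i < n) g i (x i).
  by apply: prodr_ge0 => i _; have [_ + _] := dg i; exact.
(* The empty set admits no net and is treated apart. *)
have [A0|/nonemptyPn ->] := pselect (A !=set0); last first.
  have -> : mink set0 eps (@eball R n) `\` set0 = set0.
    by apply/seteqP; split => // x [[a [b []]]].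
  rewrite /prod_dens_measure.
  under [X in iter_int X]eq_fun do rewrite indic0 mulr0.
  rewrite iter_int0 lee_fin; apply: sumr_ge0 => k _.
  by rewrite !mulr_ge0.
apply/lee_addgt0Pr => e e0.
(* The extra mass, [2 * del] times the sum of the [M k], is then at most [e]; the added 1 covers a
   zero sum. *)
pose del := e / (2 * (1 + \sum_(k < n) M k)).
have sM : 0 <= \sum_(k < n) M k by apply: sumr_ge0.
have del0 : 0 < del by rewrite divr_gt0 // mulr_gt0 // ltr_pwDl.
have [p Ap pA] := countable_net A0 del0.
pose eta := eps + del.
have eta0 : 0 <= eta by rewrite addr_ge0 // ltW.
pose S (k : 'I_n) := hull p (step_width eta k.+1) `\` hull p (step_width eta k).
have mS k : plot_measurable (S k).
  by apply: plot_measurableD; exact: plot_measurable_hull.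
have sub x : (mink A eps (@eball R n) `\` A) x -> exists k, S k x.
  move=> [[a [b [Aa [Bb ->]]]] nAx]; apply: hull_telescope; split; last first.
    by move=> h; apply: nAx; exact: hull0_sub h.
  have [j aj] := pA _ Aa; apply: (@hull_point _ _ _ j) => i.
  rewrite /step_width ltn_ord /eta addrAC addrC.
  apply: le_trans (ler_normD _ _) _; apply: lerD; last exact: aj.
  rewrite normrM (ger0_norm eps0) -[leRHS]mulr1 ler_wpM2l //.
  exact: eball_coord.
(* The set on the left may be non-measurable; monotonicity of the lower integral passes to the
   measurable slabs that cover it. *)
apply: (@le_trans _ _ (iter_int (fun x =>
  \sum_(k < n) (\prod_(i < n) g i (x i) * (1 * \1_(S k) x))%:E)%E)).
  apply: le_iter_int => x; first by rewrite lee_fin mulr_ge0.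
  rewrite sumEFin lee_fin -mulr_sumr ler_wpM2l //.
  rewrite indicE.
  have [|_] := boolP (x \in _); last by apply: sumr_ge0 => k _; rewrite mul1r.
  rewrite inE => /sub[k Sk]; rewrite (bigD1 k) //= mul1r indicE mem_set // lerDl.
  by apply: sumr_ge0 => l _; rewrite mul1r.
rewrite iter_int_sum; first last.
- by move=> k y; rewrite lee_fin mulr_ge0 // mul1r.
- by move=> k; exact: plot_measurable_density.
apply: (@le_trans _ _ (\sum_(k < n) (1 * (M k * (2 * eta)))%:E)%E).
  apply: lee_sum => k _; apply: (iter_int_slab (k := k)) => //.
    by rewrite mulr_ge0.
  by move=> x; exact: hull_step_slab.
rewrite sumEFin -EFinD lee_fin /eta.
under eq_bigr do rewrite mul1r.
rewrite -!mulr_suml mulrDr mulrDr lerD2l /del.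
have -> : (\sum_(i < n) M i) * (2 * (e / (2 * (1 + \sum_(k < n) M k)))) =
   e * ((\sum_(i < n) M i) / (1 + \sum_(k < n) M k)).
  by field; rewrite gt_eqF // ltr_pwDl.
rewrite -[leRHS]mulr1 ler_pM2l // ler_pdivrMr ?ltr_pwDl // mul1r lerDr //.
Qed.

End UpperBound.

(** * Surface measure *)

Section SurfaceMeasure.
Variable R : realType.
Local Notation mu := (@lebesgue_measure R).

Lemma lebesgue_measureT_gt0 : (0 < mu [set: R])%E.
Proof.
apply: (@lt_le_trans _ _ (mu `[0, 1]%classic)).
  by rewrite lebesgue_measure_itv /= lte_fin ltr01 oppr0 adde0 lte01.
by apply: le_measure => //; rewrite inE.
Qed.

Lemma Linf_norm_fin (g : R -> R) : prob_density_Linf g ->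
  [/\ is_density g, 0 <= fine (Linf_norm g), Linf_norm g = (fine (Linf_norm g))%:E &
      {ae mu, forall t, g t <= fine (Linf_norm g)}].
Proof.
move=> [mg g0 ig gfin].
have L0 : (0 <= Linf_norm g)%E.
  by apply: ess_sup_ger => [|t]; [exact: lebesgue_measureT_gt0|rewrite lee_fin].
have Lfin : Linf_norm g = (fine (Linf_norm g))%:E.
  by rewrite fineK // ge0_fin_numE.
split => //; first exact: fine_ge0.
have := ess_sup_ge mu (fun x => (`|g x|)%:E).
apply: (@filterS _ _ (ae_filter_ringOfSetsType mu)) => t.
rewrite -/(Linf_norm g) Lfin lee_fin; apply: le_trans; exact: ler_norm.
Qed.

(** The quotient is bounded at every [eps > 0], so one positive [e] in each neighbourhood [V] bounds
    the infimum over [V]. *)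
Lemma surf_measure_le n (g : 'I_n -> R -> R) (A : set ('I_n -> R)) :
  (forall k, prob_density_Linf (g k)) -> convex_set A ->
  (surf_measure (prod_dens_measure g) A <= 2%:E * \sum_(k < n) Linf_norm (g k))%E.
Proof.
move=> dg cA.
pose M k := fine (Linf_norm (g k)).
have -> : (2%:E * \sum_(k < n) Linf_norm (g k) = (2 * \sum_(k < n) M k)%:E)%E.
  rewrite EFinM -sumEFin; congr (_ * _)%E; apply: eq_bigr => k _.
  by have [_ _ -> _] := Linf_norm_fin (dg k).
rewrite /surf_measure limf_einfE; apply: ge_ereal_sup => _ [V FV <-].
have [e [Ve e0]] : exists e, V e /\ 0 < e.
  have : \forall e \near (0 : R)^'+, V e /\ 0 < e.
    by apply: filterI => //; exact: nbhs_right_gt.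
  by move/filter_ex.
apply: le_trans (ereal_inf_lbound _) _; first by exists e.
have := @density_mink_le R n g M A e _ _ _ cA (ltW e0).
have dgk k := Linf_norm_fin (dg k).
move=> /(_ (fun k => let: And4 h _ _ _ := dgk k in h)
  (fun k => let: And4 _ h _ _ := dgk k in h) (fun k => let: And4 _ _ _ h := dgk k in h)).
move=> h; have := @lee_wpmul2r _ (e^-1)%:E _ _ _ h.
rewrite lee_fin invr_ge0 (ltW e0) => /(_ isT) /le_trans; apply.
rewrite -EFinM lee_fin -mulr_suml.
by have -> : (\sum_(k < n) M k) * (2 * e) / e = 2 * \sum_(k < n) M k :> R
  by field; rewrite gt_eqF.
Qed.

End SurfaceMeasure.

(** * Sharpness of the constant 2 *)

Section Optimality.
Variable R : realType.
Local Notation mu := (@lebesgue_measure R).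

Definition uniform_density : 'I_1 -> R -> R := fun=> \1_(`[0, 1]%classic).

Lemma prob_density_uniform k : prob_density_Linf (uniform_density k).
Proof.
split.
- by apply: measurable_indic.
- by move=> x; rewrite /uniform_density indicE ler0n.
- rewrite integral_indic // setIT /= lebesgue_measure_itv /= lte_fin ltr01.
  by rewrite oppr0 adde0.
- apply: (@le_lt_trans _ _ 1%:E); last exact: ltry.
  apply: ess_sup_ler => t.
  by rewrite lee_fin /uniform_density indicE; case: (_ \in _); rewrite ?normr1 ?normr0.
Qed.

Lemma Linf_norm_uniform k : (Linf_norm (uniform_density k) <= 1)%E.
Proof.
apply: ess_sup_ler => t.
by rewrite lee_fin /uniform_density indicE; case: (_ \in _); rewrite ?normr1 ?normr0.
Qed.

Lemma surf_measure_uniform :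
  (2%:E <= surf_measure (prod_dens_measure uniform_density) [set fun=> 2^-1%R])%E.
Proof.
rewrite /surf_measure limf_einfE.
set f := (fun eps : R => _).
(* For [e] at most one half the interval around the point stays inside [[0,1]], and the quotient is
   at least [2 * e / e]. *)
apply: (@le_trans _ _ (ereal_inf (f @` [set e | 0 < e /\ e <= 2^-1]))); last first.
  apply: ereal_sup_ubound => /=; exists [set e | 0 < e /\ e <= 2^-1] => //.
  by apply: filterI; [exact: nbhs_right_gt|apply: nbhs_right_le; rewrite invr_gt0].
apply: le_ereal_inf_tmp => _ [e [e0 e2] <-]; rewrite /f.
(* The two halves of the punctured interval around the point. *)
pose B1 : set R := `[2^-1 - e, 2^-1[%classic.
pose B2 : set R := `]2^-1, 2^-1 + e]%classic.
have mB1 : measurable (B1 : set (measurableTypeR R)) by exact: measurable_itv.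
have mB2 : measurable (B2 : set (measurableTypeR R)) by exact: measurable_itv.
have B12 : mu (B1 `|` B2) = (2 * e)%:E.
  rewrite measureU //.
    rewrite /= !lebesgue_measure_itv /= !lte_fin ltrBlDr ltrDl e0 -EFinB -EFinD.
    by congr EFin; ring.
  apply/seteqP; split => // t []; rewrite /B1 /B2 /= !in_itv /=; lra.
have -> : 2%:E = ((2 * e)%:E * (e^-1)%:E)%E.
  by rewrite -EFinM -mulrA mulfV ?mulr1 // gt_eqF.
apply: lee_wpmul2r; first by rewrite lee_fin invr_ge0 ltW.
rewrite -B12 -[X in mu X]setIT -integral_indic //; last exact: measurableU.
rewrite /prod_dens_measure /=; apply: le_lower_integral => t.
  by rewrite lee_fin indicE ler0n.
rewrite lee_fin big_ord_recl big_ord0 mulr1 vcons0 indicE.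
have [|_] := boolP (t \in _); last by rewrite mulr_ge0 // indicE ler0n.
rewrite inE => tB.
have [t1 t2 tn] : [/\ 2^-1 - e <= t, t <= 2^-1 + e & t != 2^-1].
  case: tB; rewrite /B1 /B2 /= in_itv /= => /andP[a b]; split;
    rewrite ?(lt_eqF b) ?(gt_eqF a) //; lra.
rewrite /uniform_density !indicE !mem_set ?mulr1 //.
  split; last first.
    by move=> /(congr1 (fun h => h ord0)); rewrite vcons0 => /eqP; exact/negP.
  (* The ball vector is the displacement from the centre to [t], rescaled by [e]. *)
  exists (fun=> 2^-1), (fun=> (t - 2^-1) / e); split => //; split.
    rewrite /eball /= big_ord_recl big_ord0 addr0 expr_div_n.
    rewrite ler_pdivrMr ?exprn_gt0 // mul1r; nra.
  apply/funext => i; rewrite ord1 vcons0 mulrC divfK ?gt_eqF //.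
  by rewrite addrC subrK.
by rewrite /= in_itv /=; lra.
Qed.

End Optimality.

Lemma convex_set1 (R : realType) n (x : 'I_n -> R) : convex_set [set x].
Proof.
by move=> y z t; rewrite !inE => -> ->; rewrite convmm.
Qed.

Unset Implicit Arguments.

Theorem theorem5p10 (R : realType) :
  (forall (n : nat) (g : 'I_n -> R -> R),
    (forall k, prob_density_Linf (g k)) ->
    (forall A : set ('I_n -> R), convex_set A ->
       (surf_measure (prod_dens_measure g) A
          <= 2%:E * \sum_(k < n) Linf_norm (g k))%E) /\
    (Gamma (prod_dens_measure g) <= 2%:E * \sum_(k < n) Linf_norm (g k))%E)
  /\
  (forall c : R, c < 2 ->
    exists (n : nat) (g : 'I_n -> R -> R),
      (forall k, prob_density_Linf (g k)) /\
      exists A : set ('I_n -> R), convex_set A /\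
        (c%:E * \sum_(k < n) Linf_norm (g k) < surf_measure (prod_dens_measure g) A)%E).
Proof.
split=> [n g dg|c c2].
  split=> [A cA|]; first exact: surf_measure_le.
  by apply: ge_ereal_sup => _ [A [cA _] <-]; exact: surf_measure_le.
exists 1, (@uniform_density R); split; first exact: prob_density_uniform.
exists [set fun=> 2^-1]; split; first exact: convex_set1.
apply: lt_le_trans (surf_measure_uniform R).
rewrite big_ord_recl big_ord0 adde0.
have [_ L0 LE _] := Linf_norm_fin (prob_density_uniform R ord0).
have := Linf_norm_uniform R ord0; rewrite LE -EFinM lee_fin lte_fin => L1.
(* For [c <= 0] the product is at most 0; otherwise the norm, being at most 1, keeps it at most
   [c]. *)
by have [c0|/ltW c0] := leP c 0; nra.
Qed.
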